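(* Let $p$ be a prime and let $(A,+,\cdot)$ be a pre-Lie algebra over $\mathbb{F}_p$ with $(A,+)\cong C_p^5$, generated by three elements $x,y,z$ (and by no fewer elements) as a pre-Lie algebra. Suppose $A^{[3]}\neq 0$ and $A^{[4]}=0$. Put $S'=\{x\cdot x,\ x\cdot y,\ x\cdot z,\ y\cdot x,\ y\cdot y,\ y\cdot z,\ z\cdot x,\ z\cdot y,\ z\cdot z\}$. Then the following hold. (1) $A$ has an $\mathbb{F}_p$-basis $\{x,y,z,u,v\}$ where $u\in S'\setminus A^{[3]}$ and $v$ is of the form $c\cdot d$ with $c\in S'\setminus A^{[3]}$ and $d\in\{x,y,z\}$, or vice versa. (2) $A^{[2]}/A^{[3]}=\mathbb{F}_pu$ and $A^{[3]}=\mathbb{F}_pv$. (3) For $i,j\in\{x,y,z\}$ write $i\cdot j=\alpha_{ij}u+\beta_{ij}v$ with $\alpha_{ij},\beta_{ij}\in\mathbb{F}_p$; not all $\alpha_{ij}$ are $0$. For $k=u$, $l\in\{x,y,z\}$, or vice versa, write $k\cdot l=\delta_{kl}v$ with $\delta_{kl}\in\mathbb{F}_p$. Then $$\alpha_{xy}\delta_{ux}-\alpha_{yx}\delta_{xu}=\alpha_{yx}\delta_{ux}-\alpha_{xx}\delta_{yu},\qquad \alpha_{yx}\delta_{uy}-\alpha_{xy}\delta_{yu}=\alpha_{xy}\delta_{uy}-\alpha_{yy}\delta_{xu},$$ $$\alpha_{xz}\delta_{ux}-\alpha_{zx}\delta_{xu}=\alpha_{zx}\delta_{ux}-\alpha_{xx}\delta_{zu},\qquad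 \alpha_{zx}\delta_{uz}-\alpha_{xz}\delta_{zu}=\alpha_{xz}\delta_{uz}-\alpha_{zz}\delta_{xu},$$ $$\alpha_{yz}\delta_{uy}-\alpha_{zy}\delta_{yu}=\alpha_{zy}\delta_{uy}-\alpha_{yy}\delta_{zu},\qquad \alpha_{zy}\delta_{uz}-\alpha_{yz}\delta_{zu}=\alpha_{yz}\delta_{uz}-\alpha_{zz}\delta_{yu},$$ $$\alpha_{xy}\delta_{uz}-\alpha_{yz}\delta_{xu}=\alpha_{yx}\delta_{uz}-\alpha_{xz}\delta_{yu},\qquad \alpha_{yz}\delta_{ux}-\alpha_{zx}\delta_{yu}=\alpha_{zy}\delta_{ux}-\alpha_{yx}\delta_{zu},$$ $$\alpha_{xz}\delta_{uy}-\alpha_{zy}\delta_{xu}=\alpha_{zx}\delta_{uy}-\alpha_{xy}\delta_{zu}.$$ (4) Conversely, if $A$ is a five-dimensional $\mathbb{F}_p$-vector space with a bilinear product (not assumed to be pre-Lie) generated by $x,y,z$, with $A^{[3]}\ne0$, $A^{[4]}=0$, and satisfying (1)–(3), then $A$ is a well defined pre-Lie algebra.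
   Context: A pre-Lie algebra over $\mathbb{F}_p$ is an $\mathbb{F}_p$-vector space $A$ with a bilinear product $\cdot$ satisfying $(a\cdot b)\cdot c-a\cdot(b\cdot c)=(b\cdot a)\cdot c-b\cdot(a\cdot c)$ for all $a,b,c\in A$. For subspaces $B,C\subseteq A$, $B\cdot C$ denotes the subspace spanned by all $b\cdot c$ with $b\in B$, $c\in C$. Define (for any bilinear product) $A^{[1]}=A$ and $A^{[i+1]}=\sum_{j=1}^{i}A^{[j]}\cdot A^{[i+1-j]}$ for $i\ge 1$. $A^{[2]}/A^{[3]}=\mathbb{F}_pu$ means the quotient is spanned by the image of $u$. *)

(* Defs.v *)
From HB Require Import structures.
From mathcomp Require Import all_boot all_order all_algebra all_field.
From mathcomp Require Import sesquilinear.
Set Implicit Arguments. Unset Strict Implicit. Unset Printing Implicit Defensive.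
Import GRing.Theory.
Local Open Scope ring_scope.

Section NonassociativeAlgebra.

Variables (F : finFieldType) (A : vectType F) (mul : A -> A -> A).

Definition pre_Lie : Prop := forall a b c : A,
  mul (mul a b) c - mul a (mul b c) = mul (mul b a) c - mul b (mul a c).

(* [finvect_type A] is [A] with its finite type structure (the base field is
   finite), so that one can list all the elements of a subspace. *)
Definition prod_space (B C : {vspace A}) : {vspace A} :=
  <<[seq mul b c | b <- enum [pred b : finvect_type A | b \in B],
                   c <- enum [pred c : finvect_type A | c \in C]]>>%VS.

(* Course-of-values recursion on [i], with [n] an upper bound on the depth;
   only the values at [n = i >= 1] are meaningful, see [alg_pow1] and
   [alg_powS]. *)
Fixpoint alg_pow_rec (n i : nat) : {vspace A} :=
  if n is n'.+1 then
    if (i <= 1)%N then fullv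
    else (\sum_(1 <= j < i)
            prod_space (alg_pow_rec n' j) (alg_pow_rec n' (i - j)))%VS
  else fullv.

Definition alg_pow (i : nat) : {vspace A} := alg_pow_rec i i.

Lemma alg_pow_rec_stable n m i :
  (i <= n)%N -> (i <= m)%N -> alg_pow_rec n i = alg_pow_rec m i.
Proof.
elim: n m i => [|n IHn] [|m] i //=.
- by rewrite leqn0 => /eqP->.
- by move=> _; rewrite leqn0 => /eqP->.
move=> le_in le_im; case: ifP => // _.
apply: eq_big_nat => j /andP[j_gt0 lt_ji].
have le_jn : (j <= n)%N by rewrite -ltnS (leq_trans lt_ji).
have le_jm : (j <= m)%N by rewrite -ltnS (leq_trans lt_ji).
have lt_iji : (i - j < i)%N by rewrite ltn_subrL j_gt0 (leq_trans _ lt_ji).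
by congr prod_space; apply: IHn => //; rewrite -ltnS (leq_trans lt_iji).
Qed.

Lemma alg_pow1 : alg_pow 1 = fullv.
Proof. by []. Qed.

Lemma alg_powS i : (0 < i)%N ->
  alg_pow i.+1 =
    (\sum_(1 <= j < i.+1) prod_space (alg_pow j) (alg_pow (i.+1 - j)))%VS.
Proof.
move=> i_gt0; rewrite /alg_pow /= ltnS leqNgt i_gt0 /=.
apply: eq_big_nat => j /andP[j_gt0 le_ji].
congr prod_space; apply: alg_pow_rec_stable => //.
by rewrite -ltnS ltn_subrL j_gt0.
Qed.

Definition generates (s : seq A) : Prop :=
  forall B : {vspace A}, {subset s <= B} ->
    (forall b c, b \in B -> c \in B -> mul b c \in B) -> B = fullv.

Variables x y z : A.

Definition products : seq A :=
  [:: mul x x; mul x y; mul x z;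
      mul y x; mul y y; mul y z;
      mul z x; mul z y; mul z z].

Definition basis_property (u v : A) : Prop :=
  [/\ basis_of fullv [:: x; y; z; u; v],
      u \in products, u \notin alg_pow 3
    & exists c d : A,
        [/\ c \in products, c \notin alg_pow 3, d \in [:: x; y; z]
          & v = mul c d \/ v = mul d c]].

(* The first conjunct says that A^[2] / A^[3] is spanned by the class of [u]. *)
Definition quotient_property (u v : A) : Prop :=
  alg_pow 2 = (<[u]> + alg_pow 3)%VS /\ alg_pow 3 = <[v]>%VS.

(* The coefficients are indexed by the vectors themselves; only their values
   at [x], [y], [z] and, for [delta], [u] are constrained. *)
Definition coefficient_property (u v : A) : Prop :=
  exists alpha beta delta : A -> A -> F,
    [/\ forall i j, i \in [:: x; y; z] -> j \in [:: x; y; z] ->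
          mul i j = alpha i j *: u + beta i j *: v,
        exists i j, [/\ i \in [:: x; y; z], j \in [:: x; y; z]
                      & alpha i j != 0],
        forall l, l \in [:: x; y; z] ->
          mul u l = delta u l *: v /\ mul l u = delta l u *: v
      & [/\
          alpha x y * delta u x - alpha y x * delta x u
            = alpha y x * delta u x - alpha x x * delta y u /\
          alpha y x * delta u y - alpha x y * delta y u
            = alpha x y * delta u y - alpha y y * delta x u,
          alpha x z * delta u x - alpha z x * delta x u
            = alpha z x * delta u x - alpha x x * delta z u /\
          alpha z x * delta u z - alpha x z * delta z u
            = alpha x z * delta u z - alpha z z * delta x u,
          alpha y z * delta u y - alpha z y * delta y u
            = alpha z y * delta u y - alpha y y * delta z u /\
          alpha z y * delta u z - alpha y z * delta z u
            = alpha y z * delta u z - alpha z z * delta y u,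
          alpha x y * delta u z - alpha y z * delta x u
            = alpha y x * delta u z - alpha x z * delta y u /\
          alpha y z * delta u x - alpha z x * delta y u
            = alpha z y * delta u x - alpha y x * delta z u
        & alpha x z * delta u y - alpha z y * delta x u
            = alpha z x * delta u y - alpha x y * delta z u]].

End NonassociativeAlgebra.

(* Main.v *)
Require Import Defs.
From HB Require Import structures.
From mathcomp Require Import all_boot all_order all_algebra all_field.
From mathcomp Require Import sesquilinear.
Set Implicit Arguments. Unset Strict Implicit. Unset Printing Implicit Defensive.
Import GRing.Theory.
Local Open Scope ring_scope.

(** In an algebra with A^[n+1] = 0, a subalgebra B with B + A^[2] = A is all of
    A: by induction on m, substituting A = B + A^[m] in A * A gives
    A^[2] <= B + A^[m+1], hence A = B + A^[m+1] (Nakayama's argument).  So a set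
    generates A exactly when it spans A modulo A^[2] ([span_pow2_full],
    [generates_mod_pow2]), and a basis of a complement of A^[2] is a generating
    set; if fewer than three elements never generate and dim A = 5, then
    dim A^[2] <= 2 ([dim_pow2_leq]).  The inclusions 0 < A^[3] < A^[2] are strict
    in class three, because A^[2] = A^[3] would give A^[3] <= A^[4] = 0.  Hence
    dim A^[2] = 2 and dim A^[3] = 1 ([dim_pow23]).

    The products of generators span A^[2] modulo A^[3], so one of them is a
    vector u outside A^[3], and A^[2] = <u> + A^[3].  Then A^[3] is spanned by
    the products of u with a generator on either side, so some such product is a
    nonzero vector v, which spans A^[3].  This is the basis x, y, z, u, v
    ([exists_basis_property]), and the description of A^[2] and A^[3] holds for
    any such u and v because it only uses dimensions.

    Every triple product with a factor in A^[2] lies in A^[4] = 0.  The pre-Lie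
    identity being trilinear, it therefore holds as soon as it holds on triples
    of generators ([pre_Lie_generators]).  On generators,
    (a b) c = alpha_ab delta_uc v and a (b c) = alpha_bc delta_au v, so the
    identity at (a, b, c) is one equation between scalars.  That equation is
    antisymmetric in a and b, hence the 27 triples amount to the nine equations
    with a and b distinct: this gives both the necessity
    ([basis_coefficient_property]) and the sufficiency ([coefficient_pre_Lie]).
*)

(** * Linear algebra *)

(** For predicates that are closed under linear combinations without being
    packaged as a subspace, such as an identity in one of its arguments. *)
Lemma span_ind (K : fieldType) (V : vectType K) (P : V -> Prop) (X : seq V) :
    P 0 -> (forall k a b, P a -> P b -> P (k *: a + b)) ->
    {in X, forall a, P a} ->
  {in <<X>>%VS, forall a, P a}.
Proof.
move=> P0 Plin PX a /(@coord_span _ _ _ (in_tuple X))->.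
elim/big_ind: _ => // [b c Pb Pc | i _].
  by rewrite -[b]scale1r; apply: Plin.
by rewrite -[_ *: _]addr0; apply: Plin => //; apply/PX/mem_nth.
Qed.

(** Over a finite field the cardinality of a space determines its dimension. *)
Lemma dim_bijective_rV (F : finFieldType) (A : vectType F) (n : nat)
    (f : A -> 'rV[F]_n) :
  bijective f -> \dim {:A} = n.
Proof.
move=> f_bij; have r2v_bij : bijective (@VectorInternalTheory.r2v F A).
  by exists (@VectorInternalTheory.v2r F A);
    [apply: VectorInternalTheory.r2vK | apply: VectorInternalTheory.v2rK].
have /eqP := bij_eq_card (bij_comp f_bij r2v_bij).
by rewrite !card_mx !mul1n eqn_exp2l ?finNzRing_gt1 // dimvf => /eqP.
Qed.

(** * Powers of a nonassociative algebra *)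

Section AlgPow.

Variables (F : finFieldType) (A : vectType F) (mul : {bilinear A -> A -> A}).

Implicit Types (a b c u v : A) (s : seq A) (B C W : {vspace A}) (i j n : nat).

Local Notation pow := (alg_pow mul).

Let mem_enum_vspace B b :
  (b \in enum [pred d : finvect_type A | d \in B]) = (b \in B).
Proof. exact: mem_enum. Qed.

Lemma mem_prod_space B C b c :
  b \in B -> c \in C -> mul b c \in prod_space mul B C.
Proof.
move=> bB cC; apply: memv_span.
by apply: allpairs_f; rewrite mem_enum_vspace.
Qed.

Lemma prod_space_subv B C W :
    {in B & C, forall b c, mul b c \in W} -> (prod_space mul B C <= W)%VS.
Proof.
move=> BC_W; apply/span_subvP => _ /allpairsP[[b c] /= [+ + ->]].
by rewrite !mem_enum_vspace; apply: BC_W.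
Qed.

Lemma mul_mem_pow i j b c : (0 < i)%N -> (0 < j)%N ->
  b \in pow i -> c \in pow j -> mul b c \in pow (i + j).
Proof.
move=> i_gt0 j_gt0 bi cj.
have i_range : i \in index_iota 1 (i + j).
  by rewrite mem_index_iota i_gt0 -[X in (X < _)%N]addn0 ltn_add2l.
have -> : (i + j = (i + j).-1.+1)%N by rewrite prednK // addn_gt0 i_gt0.
rewrite alg_powS; last by rewrite -subn1 subn_gt0 (leq_add i_gt0 j_gt0).
rewrite prednK ?addn_gt0 ?i_gt0 // (big_rem i) //= addKn.
by apply: subv_trans (addvSl _ _); apply: mem_prod_space.
Qed.

(** The universal property of the sum that defines A^[n+1]. *)
Lemma pow_subv n W : (0 < n)%N ->
    (forall i j, (0 < i)%N -> (0 < j)%N -> (i + j)%N = n.+1 ->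
       {in pow i & pow j, forall b c, mul b c \in W}) ->
  (pow n.+1 <= W)%VS.
Proof.
move=> n_gt0 mulW; rewrite alg_powS // big_seq.
elim/big_ind: _ => [||i]; first exact: sub0v.
  by move=> B C BW CW; rewrite subv_add BW.
rewrite mem_index_iota => /andP[i_gt0 lt_in].
apply: prod_space_subv; apply: mulW i_gt0 _ (subnKC (ltnW lt_in)).
by rewrite subn_gt0.
Qed.

(** In a product of weights i + j = n + 1 > 2 one of the two factors has weight
    at least 2, and by induction its weight can be lowered by one. *)
Lemma powSS n : (0 < n)%N -> (pow n.+1 <= pow n)%VS.
Proof.
elim/ltn_ind: n => -[|[|n]] // IHn _; first exact: subvf.
apply: pow_subv => // -[|[|i]] // [|j] // _ _ eq_ij b c.
  case: eq_ij => -> b_in c_in; apply: (@mul_mem_pow 1 n.+1) => //.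
  exact: (subvP (IHn _ _ _)) c_in.
case: eq_ij => eq_ij b_in c_in; rewrite -eq_ij.
apply: (@mul_mem_pow i.+1 j.+1) => //; apply: (subvP (IHn _ _ _)) b_in => //.
by rewrite -eq_ij addnS ltnS leq_addr.
Qed.

Lemma mul_mem_pow2 b c : mul b c \in pow 2.
Proof. by apply: (@mul_mem_pow 1 1); rewrite ?memvf. Qed.

(** <s> + A^[2] is a subalgebra, since it contains every product. *)
Lemma span_pow2_full s : generates mul s -> (<<s>> + pow 2)%VS = fullv.
Proof.
move=> gen_s; apply: gen_s => [a s_a | b c _ _].
  exact: (subvP (addvSl _ _)) (memv_span s_a).
exact: (subvP (addvSr _ _)) (mul_mem_pow2 b c).
Qed.

(** Expanding (b + r) (c + t) with b, c in B and r, t in A^[n+1], every term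
    but b c has weight at least n + 2. *)
Lemma pow2_subv_mod B W n : (B + pow n.+1)%VS = fullv ->
    {in B &, forall b c, mul b c \in W} ->
  (pow 2 <= W + pow n.+2)%VS.
Proof.
move=> Bn_full BB_W; apply: pow_subv => // i j _ _ _ b c _ _.
have /memv_addP[b1 b1B [r rn ->]] : b \in (B + pow n.+1)%VS.
  by rewrite Bn_full memvf.
have /memv_addP[c1 c1B [t tn ->]] : c \in (B + pow n.+1)%VS.
  by rewrite Bn_full memvf.
rewrite linearDl /= linearDr /= -addrA memv_add ?BB_W // rpredD //.
  by apply: (@mul_mem_pow 1 n.+1); rewrite ?memvf.
by rewrite -addn1; apply: mul_mem_pow; rewrite ?memvf.
Qed.

(** Nakayama's lemma for nilpotent nonassociative algebras. *)
Lemma generates_mod_pow2 s n :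
  pow n.+1 = 0%VS -> (<<s>> + pow 2)%VS = fullv -> generates mul s.
Proof.
move=> pow0 sA B sB mulB.
have spanB : (<<s>> <= B)%VS by apply/span_subvP.
suffices powB m : (B + pow m.+1)%VS = fullv.
  by rewrite -(powB n) pow0 addv0.
elim: m => [|m IHm]; first by rewrite addvf.
apply: subv_anti; rewrite subvf /= -sA subv_add.
by rewrite (subv_trans spanB (addvSl _ _)) (pow2_subv_mod IHm).
Qed.

(** A basis of a complement of A^[2] generates, and it has dim A - dim A^[2]
    elements. *)
Lemma dim_pow2_leq n k :
    pow n.+1 = 0%VS -> (forall s, generates mul s -> (k <= size s)%N) ->
  (\dim (pow 2) + k <= \dim {:A})%N.
Proof.
move=> pow0 min_k.
have /min_k : generates mul (vbasis (pow 2)^C)%VS.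
  apply: generates_mod_pow2 pow0 _.
  by rewrite (span_basis (vbasisP _)) addvC addv_complf.
by rewrite size_tuple dimv_compl leq_subRL // dimvS // subvf.
Qed.

Lemma mul_mem_span s t W : {in s & t, forall b c, mul b c \in W} ->
  {in <<s>>%VS & <<t>>%VS, forall b c, mul b c \in W}.
Proof.
move=> stW b c b_s c_t; move: b b_s; apply: span_ind => [|k b d bW dW|b b_s].
- by rewrite linear0l rpred0.
- by rewrite linearPl rpredD ?rpredZ.
move: c c_t; apply: span_ind => [|k c d cW dW|c c_t].
- by rewrite linear0r rpred0.
- by rewrite linearPr rpredD ?rpredZ.
exact: stW.
Qed.

(** Both sides of the identity are trilinear. *)
Lemma pre_Lie_span s : <<s>>%VS = fullv ->
    (forall a b c, a \in s -> b \in s -> c \in s ->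
       mul (mul a b) c - mul a (mul b c) = mul (mul b a) c - mul b (mul a c)) ->
  pre_Lie mul.
Proof.
move=> s_full preL a b c.
have s_in d : d \in <<s>>%VS by rewrite s_full memvf.
have linB (k : F) (d e d' e' : A) :
    k *: d + e - (k *: d' + e') = k *: (d - d') + (e - e').
  by rewrite scalerBr opprD addrACA.
move: a (s_in a); apply: span_ind => [|k a a' IHa IHa'|a a_s].
- by rewrite !(linear0l, linear0r).
- by rewrite !(linearPl, linearPr) /= !linB IHa IHa'.
move: b (s_in b); apply: span_ind => [|k b b' IHb IHb'|b b_s].
- by rewrite !(linear0l, linear0r).
- by rewrite !(linearPl, linearPr) /= !linB IHb IHb'.
move: c (s_in c); apply: span_ind => [|k c c' IHc IHc'|c c_s].
- by rewrite !linear0r.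
- by rewrite !linearPr /= !linB IHc IHc'.
exact: preL.
Qed.

Lemma pow3_subv W :
    (forall b c, c \in pow 2 -> mul b c \in W /\ mul c b \in W) ->
  (pow 3 <= W)%VS.
Proof.
move=> mulW; apply: pow_subv => // i j i_gt0 j_gt0 ij3 b c b_in c_in.
have [i1 | i_neq1] := eqVneq i 1%N.
  have j2 : j = 2%N by move: ij3; rewrite i1 => -[].
  by case: (mulW b c); rewrite -?j2.
have i2 : i = 2%N.
  apply/eqP; rewrite eqn_leq -ltnS -ij3 -addn1 leq_add2l j_gt0 /=.
  by rewrite ltn_neqAle eq_sym i_neq1.
by case: (mulW c b); rewrite -?i2.
Qed.

(** * Algebras with vanishing fourth power *)

Section ClassThree.

Hypothesis pow4 : pow 4 = 0%VS.

Lemma mul_pow4 i j b c : (0 < i)%N -> (0 < j)%N -> (i + j = 4)%N ->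
  b \in pow i -> c \in pow j -> mul b c = 0.
Proof.
move=> i_gt0 j_gt0 ij4 bi cj; apply/eqP.
by rewrite -memv0 -pow4 -ij4 mul_mem_pow.
Qed.

(** A triple product with a factor in A^[2] has weight at least 4, so it
    vanishes; the vectors of A^[2] that complete s to a spanning set satisfy the
    identity for free. *)
Lemma pre_Lie_generators s : generates mul s ->
    (forall a b c, a \in s -> b \in s -> c \in s ->
       mul (mul a b) c - mul a (mul b c) = mul (mul b a) c - mul b (mul a c)) ->
  pre_Lie mul.
Proof.
move=> gen_s preL.
have mul_mul_l0 d e f : d \in pow 2 \/ e \in pow 2 \/ f \in pow 2 ->
    mul (mul d e) f = 0.
  case=> [d2|[e2|f2]]; last exact: (mul_pow4 _ _ _ (mul_mem_pow2 d e) f2).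
    apply: (@mul_pow4 3 1); rewrite ?memvf //.
    by apply: (@mul_mem_pow 2 1); rewrite ?memvf.
  apply: (@mul_pow4 3 1); rewrite ?memvf //.
  by apply: (@mul_mem_pow 1 2); rewrite ?memvf.
have mul_mul_r0 d e f : d \in pow 2 \/ e \in pow 2 \/ f \in pow 2 ->
    mul d (mul e f) = 0.
  case=> [d2|[e2|f2]]; first exact: (mul_pow4 _ _ _ d2 (mul_mem_pow2 e f)).
    apply: (@mul_pow4 1 3); rewrite ?memvf //.
    by apply: (@mul_mem_pow 2 1); rewrite ?memvf.
  apply: (@mul_pow4 1 3); rewrite ?memvf //.
  by apply: (@mul_mem_pow 1 2); rewrite ?memvf.
apply: (@pre_Lie_span (s ++ vbasis (pow 2))).
  by rewrite span_cat (span_basis (vbasisP _)) span_pow2_full.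
move=> a b c; rewrite !mem_cat.
case/orP=> [a_s|/vbasis_mem a2] => [|_ _]; last first.
  by rewrite !mul_mul_l0 ?mul_mul_r0; auto.
case/orP=> [b_s|/vbasis_mem b2] => [|_]; last first.
  by rewrite !mul_mul_l0 ?mul_mul_r0; auto.
case/orP=> [c_s|/vbasis_mem c2]; last by rewrite !mul_mul_l0 ?mul_mul_r0; auto.
exact: preL.
Qed.

(** This and its mirror image turn triple products of generators into
    structure constants. *)
Lemma mul_mul_l a b c u v (al be de : F) : v \in pow 3 ->
    mul a b = al *: u + be *: v -> mul u c = de *: v ->
  mul (mul a b) c = (al * de) *: v.
Proof.
move=> v3 -> uc; rewrite linearPl /= linearZl_LR /= uc scalerA.
by rewrite (@mul_pow4 3 1) ?memvf // scaler0 addr0.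
Qed.

Lemma mul_mul_r a b c u v (al be de : F) : v \in pow 3 ->
    mul b c = al *: u + be *: v -> mul a u = de *: v ->
  mul a (mul b c) = (al * de) *: v.
Proof.
move=> v3 -> au; rewrite linearPr /= linearZr_LR /= au scalerA.
by rewrite (@mul_pow4 1 3) ?memvf // scaler0 addr0.
Qed.

Hypothesis pow3_neq0 : pow 3 != 0%VS.

(** If A^[2] = A^[3], then A^[3] = A A^[2] + A^[2] A = A A^[3] + A^[3] A
    is contained in A^[4]. *)
Lemma pow2_not_sub_pow3 : ~~ (pow 2 <= pow 3)%VS.
Proof.
apply: contra pow3_neq0 => sub23; rewrite -subv0.
apply: pow3_subv => b c /(subvP sub23) c3.
by rewrite (@mul_pow4 1 3) ?(@mul_pow4 3 1) ?mem0v ?memvf.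
Qed.

Lemma dim_pow23 : (\dim (pow 2) <= 2)%N ->
  \dim (pow 2) = 2%N /\ \dim (pow 3) = 1%N.
Proof.
move=> dim2; have := pow2_not_sub_pow3.
have := pow3_neq0; rewrite -dimv_eq0 -(dimv_leqif_sup (@powSS 2 isT)).
have := dimvS (@powSS 2 isT).
by move: (\dim (pow 2)) (\dim (pow 3)) dim2 => [|[|[|d]]] [|[|[|e]]].
Qed.

(** * Three generators and the basis x, y, z, u, v *)

Section Generators.

Variables x y z : A.
Hypothesis gen_xyz : generates mul [:: x; y; z].

Lemma mem_productsP w :
  reflect (exists a b, [/\ a \in [:: x; y; z], b \in [:: x; y; z]
                         & w = mul a b])
          (w \in products mul x y z).
Proof.
exact: (@allpairsPdep _ (fun=> A) _ _ [:: x; y; z] (fun=> [:: x; y; z])).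
Qed.

Lemma products_pow2 w : w \in products mul x y z -> w \in pow 2.
Proof. by case/mem_productsP=> i [j [_ _ ->]]; apply: mul_mem_pow2. Qed.

(** The products of generators span A^[2] modulo A^[3]. *)
Lemma products_notin_pow3 :
  exists2 u, u \in products mul x y z & u \notin pow 3.
Proof.
apply/hasP/negPn/negP; rewrite -all_predC => /allP prod3.
case/negP: pow2_not_sub_pow3; rewrite -[pow 3]addvv.
apply: pow2_subv_mod (span_pow2_full gen_xyz) _.
apply: mul_mem_span => i j i_in j_in; apply/negPn/prod3.
by apply/mem_productsP; exists i, j.
Qed.

(** Otherwise u would annihilate A on both sides, as A^[2] A^[2] = 0; so would
    A^[2] = <u> + A^[3], and A^[3] would be 0. *)
Lemma pow3_mul_neq0 u : u \in pow 2 -> (pow 2 <= <[u]> + pow 3)%VS ->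
  exists2 d, d \in [:: x; y; z] & (mul u d != 0) || (mul d u != 0).
Proof.
move=> u2 pow2_u; apply/hasP/negPn/negP; rewrite -all_predC => /allP mul_u0.
have u0 b : mul u b = 0 /\ mul b u = 0.
  have : b \in (<<[:: x; y; z]>> + pow 2)%VS by rewrite span_pow2_full ?memvf.
  case/memv_addP=> d d_in [r r2 ->]; rewrite linearDl linearDr /=.
  rewrite (@mul_pow4 2 2 r u) // (@mul_pow4 2 2 u r) // !addr0.
  move: d d_in; apply: span_ind => [|k d e [ud0 du0] [ue0 eu0]|d /mul_u0].
  - by rewrite linear0l linear0r.
  - by rewrite linearPl linearPr /= ud0 du0 ue0 eu0 scaler0 addr0.
  by rewrite /= negb_or !negbK => /andP[/eqP-> /eqP->].
have mul0 b c : c \in pow 2 -> mul b c = 0 /\ mul c b = 0.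
  move/(subvP pow2_u)/memv_addP=> [_ /vlineP[k ->] [r r3 ->]].
  rewrite linearDl linearDr /= linearZl_LR linearZr_LR /=.
  rewrite (@mul_pow4 3 1 r b) ?(@mul_pow4 1 3 b r) ?memvf //.
  by case: (u0 b) => -> ->; rewrite scaler0 addr0.
case/negP: pow3_neq0; rewrite -subv0.
by apply: pow3_subv => b c /(mul0 b)[-> ->]; rewrite mem0v.
Qed.

Hypotheses (dim2 : \dim (pow 2) = 2%N) (dim3 : \dim (pow 3) = 1%N).

Lemma pow2_line u : u \in pow 2 -> u \notin pow 3 ->
  pow 2 = (<[u]> + pow 3)%VS.
Proof.
move=> u2 u3; apply/esym/eqP; rewrite eqEdim subv_add -memvE u2 powSS //=.
rewrite [X in (X <= _)%N]dim2 -[X in (X < _)%N]dim3 ltn_neqAle.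
rewrite (dimv_leqif_sup (addvSr _ _)) subv_add.
by rewrite -memvE (negPf u3) dimvS ?addvSr.
Qed.

Lemma pow3_line v : v \in pow 3 -> v != 0 -> pow 3 = <[v]>%VS.
Proof.
move=> v3 v0; apply/esym/eqP.
by rewrite eqEdim -memvE v3 dim3 dim_vline v0.
Qed.

Lemma exists_basis_property : \dim {:A} = 5%N ->
  exists u v, basis_property mul x y z u v.
Proof.
move=> dimA; have [u u_prod u3] := products_notin_pow3.
have u2 := products_pow2 u_prod; have pow2E := pow2_line u2 u3.
have [|d d_in mul_du] := pow3_mul_neq0 u2; first by rewrite -pow2E.
have [v [v0 v3 vE]] :
    exists v, [/\ v != 0, v \in pow 3 & v = mul u d \/ v = mul d u].
  case/orP: mul_du => v0; [exists (mul u d) | exists (mul d u)].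
    by split; [| apply: (@mul_mem_pow 2 1); rewrite ?memvf | left].
  by split; [| apply: (@mul_mem_pow 1 2); rewrite ?memvf | right].
exists u, v; split=> //; last by exists u, d.
rewrite basisEdim dimA andbT -(span_pow2_full gen_xyz) pow2E (pow3_line v3 v0).
rewrite -[X in (_ <= <<X>>)%VS]/([:: x; y; z] ++ [:: u; v]).
by rewrite span_cat (span_cons u) span_seq1.
Qed.

Variables u v : A.
Hypothesis uvP : basis_property mul x y z u v.

Lemma basis_property_pow3 : v \in pow 3 /\ v != 0.
Proof.
case: uvP => basis _ _ [c [d [c_prod _ _ vE]]]; split.
  case: vE => ->; have c2 := products_pow2 c_prod.
    by apply: (@mul_mem_pow 2 1); rewrite ?memvf.
  by apply: (@mul_mem_pow 1 2); rewrite ?memvf.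
have := basis_free basis.
rewrite -[[:: x; y; z; u; v]]/([:: x; y; z; u] ++ [:: v]).
by rewrite cat_free seq1_free => /and3P[].
Qed.

Lemma basis_quotient_property : quotient_property mul u v.
Proof.
have [v3 v0] := basis_property_pow3; have [_ u_prod u3 _] := uvP.
by split; [apply: pow2_line (products_pow2 u_prod) u3 | apply: pow3_line].
Qed.

(** The structure constants are the coordinates along u, v in A^[2] and along v
    in A^[3]; comparing the coefficients of v in the pre-Lie identity on three
    generators gives the equations. *)
Lemma basis_coefficient_property : pre_Lie mul ->
  coefficient_property mul x y z u v.
Proof.
move=> preL; have [v3 v0] := basis_property_pow3; have [_ u_prod u3 _] := uvP.
have [pow2E pow3E] := basis_quotient_property.
have u2 := products_pow2 u_prod.
pose alpha a b : F := coord [tuple u; v] ord0 (mul a b).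
pose beta a b : F := coord [tuple u; v] (lift ord0 ord0) (mul a b).
pose delta a b : F := coord [tuple v] 0 (mul a b).
have prodE a b : mul a b = alpha a b *: u + beta a b *: v.
  have : mul a b \in <<[tuple u; v]>>%VS.
    by rewrite span_cons span_seq1 -pow3E -pow2E mul_mem_pow2.
  by move/coord_span; rewrite !big_ord_recl big_ord0 addr0.
have pow3_coord w : w \in pow 3 -> w = coord [tuple v] 0 w *: v.
  rewrite pow3E -span_seq1 => w_in.
  by rewrite {1}(@coord_span _ _ _ [tuple v] w w_in) big_ord1.
have uE l : mul u l = delta u l *: v.
  by apply/pow3_coord/(@mul_mem_pow 2 1); rewrite ?memvf.
have Eu l : mul l u = delta l u *: v.
  by apply/pow3_coord/(@mul_mem_pow 1 2); rewrite ?memvf.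
have eqs a b c : alpha a b * delta u c - alpha b c * delta a u
               = alpha b a * delta u c - alpha a c * delta b u.
  have := preL a b c.
  rewrite !(mul_mul_l v3 (prodE _ _) (uE _)) !(mul_mul_r v3 (prodE _ _) (Eu _)).
  by rewrite -!scalerBl => /eqP; rewrite -subr_eq0 -scalerBl scaler_eq0
    (negPf v0) orbF subr_eq0 => /eqP.
exists alpha, beta, delta; split=> //.
(* Not all alpha vanish: u itself is a product of two generators, and it would
   lie in A^[3] = <v>. *)
have /mem_productsP[i [j [i_in j_in uij]]] := u_prod.
exists i, j; split=> //; apply: contra u3 => /eqP al0.
by rewrite {1}uij prodE al0 scale0r add0r rpredZ.
Qed.

(** Nine equations cover the 27 triples of generators, the identity being
    antisymmetric in its first two arguments. *)
Lemma coefficient_pre_Lie : coefficient_property mul x y z u v -> pre_Lie mul.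
Proof.
have [v3 _] := basis_property_pow3.
case=> al [be [de [prodE _ deE eqs]]].
apply: (pre_Lie_generators gen_xyz) => a b c a_in b_in c_in.
rewrite !(mul_mul_l v3 (prodE _ _ _ _) (proj1 (deE _ _))) //.
rewrite !(mul_mul_r v3 (prodE _ _ _ _) (proj2 (deE _ _))) //.
rewrite -!scalerBl; congr (_ *: _).
case: eqs => [[xyx yxy] [xzx zxz] [yzy zyz] [xyz yzx] xzy].
by move: a_in b_in c_in; rewrite !inE;
  case/or3P=> /eqP->; case/or3P=> /eqP->; case/or3P=> /eqP->;
  first [done | symmetry].
Qed.

End Generators.

End ClassThree.

End AlgPow.

Theorem theorem6p2p1 (p : nat) (p_prime : prime p) :
  (forall (A : vectType 'F_p) (mul : {bilinear A -> A -> A}) (x y z : A),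
     pre_Lie mul ->
     (exists f : {additive A -> 'rV['F_p]_5}, bijective f) ->
     generates mul [:: x; y; z] ->
     (forall s : seq A, generates mul s -> (3 <= size s)%N) ->
     alg_pow mul 3 != 0%VS ->
     alg_pow mul 4 = 0%VS ->
     (exists u v : A, basis_property mul x y z u v) /\
     (forall u v : A, basis_property mul x y z u v ->
        quotient_property mul u v /\ coefficient_property mul x y z u v))
  /\
  (forall (A : vectType 'F_p) (mul : {bilinear A -> A -> A}) (x y z : A),
     \dim {:A} = 5%N ->
     generates mul [:: x; y; z] ->
     alg_pow mul 3 != 0%VS ->
     alg_pow mul 4 = 0%VS ->
     (exists u v : A,
        [/\ basis_property mul x y z u v,
            quotient_property mul u v
          & coefficient_property mul x y z u v]) ->
     pre_Lie mul).
Proof.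
split=> A mul x y z.
  move=> preL [f /dim_bijective_rV dimA] gen_xyz min3 pow3 pow4.
  have [|dim2 dim3] := dim_pow23 pow4 pow3.
    by rewrite -(leq_add2r 3) -[(2 + 3)%N]dimA (dim_pow2_leq pow4 min3).
  split=> [|u v uvP].
    exact: (exists_basis_property pow4 pow3 gen_xyz dim2 dim3).
  split; first exact: (basis_quotient_property dim2 dim3 uvP).
  exact: basis_coefficient_property.
move=> dimA gen_xyz pow3 pow4 [u [v [uvP _ coefP]]].
exact: coefficient_pre_Lie coefP.
Qed.
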